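(* Let $\mathfrak U$ be the unfolding of a system $M$ under an unconditional independence relation $I$, assumed finite, and let $\tilde C$ be a maximal configuration of $\mathfrak U$. Then in any execution of the procedure Explore described below (started with $\mathrm{Explore}(\{\bot\},\emptyset,\emptyset)$), $\mathrm{Explore}$ is called at least once with first argument equal to $\tilde C$.
   Context: $\mathfrak U=(E,<,\#,h)$ is a labelled event structure (causality $<$ a strict partial order with finite down-sets, conflict $\#$ symmetric irreflexive and inherited along $<$) with a special minimal event $\bot$; a configuration is a finite causally closed conflict-free set of events; $[e]=\{e'\le e\}$, $\lceil e\rceil=\{e'<e\}$; $e\#_ie'$ (immediate conflict) if $e\#e'$ and both $\lceil e\rceil\cup[e']$ and $[e]\cup\lceil e'\rceil$ are configurations. For a configuration $C$: $\mathrm{ex}(C)=\{e\notin C:\lceil e\rceil\subseteq C\}$, $\mathrm{en}(C)=\{e\in\mathrm{ex}(C):C\cup\{e\}\text{ is a configuration}\}$. For $U\subseteq E$, $\#_U(e)=\{e'\in U:e\#_ie'\}$. Given $U$, a configuration $C\subseteq U$ and $D\subseteq U$, an alternative to $D$ after $C$ is a configuration $J\subseteq U$ such that $C\cup J$ is a configuration and for every $e\in D$ some $e'\in C\cup J$ lies in $\#_U(e)$; $\mathrm{Alt}(X,Y)$ is the set of all alternatives (w.r.t. the current global $U$) to $Y$ after $X$. $Q_{C,D,U}=C\cup D\cup\bigcup_{e\in C\cup D,\,e'\in\#_U(e)}[e']$. Algorithm: global sets $U$ (initially $\{\bot\}$) and $G$ (initially $\emptyset$). $\mathrm{Explore}(C,D,A)$: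 (1) add $\mathrm{ex}(C)$ to $U$; (2) if $\mathrm{en}(C)\cap U=\emptyset$, return; (3) if $A=\emptyset$ choose any $e\in\mathrm{en}(C)\cap U$, else any $e\in A\cap\mathrm{en}(C)\cap U$; (4) call $\mathrm{Explore}(C\cup\{e\},D,A\setminus\{e\})$; (5) if some $J\in\mathrm{Alt}(C,D\cup\{e\})$ exists, call $\mathrm{Explore}(C,D\cup\{e\},J\setminus C)$; (6) move $\{e\}\setminus Q_{C,D,U}$ from $U$ to $G$ and, for each $\hat e\in\#_U(e)$, move $[\hat e]\setminus Q_{C,D,U}$ from $U$ to $G$. *)

(* Defs.v *)
From HB Require Import structures.
From mathcomp Require Import all_boot finmap.

Set Implicit Arguments.
Unset Strict Implicit.
Unset Printing Implicit Defensive.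

Local Open Scope fset_scope.

Record system (Sigma T : Type) := System {
  act : T -> Sigma -> option Sigma;
  init : Sigma
}.

Section System.
Variables (Sigma T : Type) (M : system Sigma T).

Definition enabled (t : T) (s : Sigma) : bool := act M t s.

Definition fire (s : Sigma) (w : seq T) : option Sigma :=
  foldl (fun o t => obind (act M t) o) (Some s) w.

Definition reachable (s : Sigma) : Prop :=
  exists w, fire (init M) w = Some s.

Definition commute_at (t u : T) (s : Sigma) : Prop :=
  (forall s', act M t s = Some s' -> enabled u s = enabled u s') /\
  (enabled t s -> enabled u s ->
   exists s', fire s [:: t; u] = Some s' /\ fire s [:: u; t] = Some s').

Definition unconditional_independence (I : rel T) : Prop :=
  [/\ symmetric I, irreflexive I &
      forall t u, I t u -> forall s, reachable s -> commute_at t u s].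

End System.

(* An event other than bottom is a pair of a transition and a finite history of
   events.  The history is stored as a sequence because a nested inductive type
   cannot go through {fset _}; [mk_event] only uses the canonical enumeration
   of a finite set, so that mk_event t H = mk_event u K iff t = u and H = K. *)
Inductive event (T : Type) : Type :=
| Bot : event T
| Ev : T -> seq (event T) -> event T.
Arguments Bot {T}.

Section EventChoice.
Variable T : Type.

Fixpoint event_encode (e : event T) : GenTree.tree T :=
  match e with
  | Bot => GenTree.Node 0 [::]
  | Ev t s => GenTree.Node 1 (GenTree.Leaf t :: map event_encode s)
  end.

Fixpoint event_decode (x : GenTree.tree T) : event T :=
  match x with
  | GenTree.Node 1 (GenTree.Leaf t :: s) => Ev t (map event_decode s)
  | _ => Bot
  end.

Lemma event_encodeK : cancel event_encode event_decode.
Proof.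
rewrite /cancel; fix IH 1; case=> [|t s] //=; congr Ev.
by elim: s => [|x s IHs] //=; rewrite IH IHs.
Qed.

End EventChoice.

HB.instance Definition _ (T : choiceType) :=
  Choice.copy (event T) (can_type (@event_encodeK T)).

Section LabelledEventStructure.
Variables (T : choiceType) (I : rel T).
Implicit Types (e : event T) (C D A J U G H : {fset event T}).

Definition mk_event (t : T) H : event T := Ev t (enum_fset H).

(* None is the empty label of bottom. *)
Definition label e : option T := if e is Ev t _ then Some t else None.

(* The set of strict causes of e: causality is e' < e iff e' \in history e.
   This is transitive on the unfolding, whose histories are causally closed. *)
Definition history e : {fset event T} :=
  if e is Ev _ s then [fset x in s] else fset0.

Definition local e : {fset event T} := e |` history e.

Definition dependent e e' : bool :=
  if (label e, label e') is (Some t, Some u) then ~~ I t u else false.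

Definition direct_conflict e e' : bool :=
  [&& e \notin local e', e' \notin local e & dependent e e'].

(* The closure of direct conflict under inheritance along causality. *)
Definition conflict e e' : bool :=
  has (fun x => has (direct_conflict x) (local e')) (local e).

Definition causally_closed C : bool := all (fun e => history e `<=` C) C.

Definition conflict_free C : bool :=
  all (fun e => all (fun e' => ~~ conflict e e') C) C.

(* A linearization of C that contains the causes of an event before it. *)
Definition interleaving C (l : seq (event T)) : Prop :=
  perm_eq l C /\ pairwise (fun e e' => e' \notin history e) l.

Definition maximal_in C e : Prop :=
  e \in C /\ forall e', e' \in C -> e \notin history e'.

End LabelledEventStructure.

Section Unfolding.
Variables (Sigma : Type) (T : choiceType) (M : system Sigma T) (I : rel T).

(* s is the state reached by firing the labels of some interleaving of C; when
   I is an independence relation this is the same state for all of them. *)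
Definition state_of (C : {fset event T}) (s : Sigma) : Prop :=
  exists2 l, interleaving C l & fire M (init M) (pmap (@label T) l) = Some s.

(* The set of events of the unfolding of M under I.  Its causality, conflict
   and labelling are [history], [conflict I] and [label]. *)
Inductive unfolding : event T -> Prop :=
| unfolding_bot : unfolding Bot
| unfolding_ev (t : T) (H : {fset event T}) (s : Sigma) :
    (forall e, e \in H -> unfolding e) ->
    Bot \in H -> causally_closed H -> conflict_free I H ->
    state_of H s -> enabled M t s ->
    H = [fset Bot] \/
      (forall e, maximal_in H e -> dependent I e (mk_event t H)) ->
    unfolding (mk_event t H).

End Unfolding.

(* E is the (finite) set of events. *)
Section Explore.
Variables (T : choiceType) (I : rel T) (E : {fset event T}).
Implicit Types (e : event T) (C D A J U G : {fset event T}).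

Definition configuration C : bool :=
  [&& C `<=` E, causally_closed C & conflict_free I C].

Definition maximal_configuration C : Prop :=
  configuration C /\ forall C', configuration C' -> C `<=` C' -> C' = C.

Definition immediate_conflict e e' : bool :=
  [&& conflict I e e', configuration (history e `|` local e')
    & configuration (local e `|` history e')].

Definition ex C := [fset e in E | (e \notin C) && (history e `<=` C)].

Definition en C := [fset e in ex C | configuration (e |` C)].

Definition conflicts_in U e := [fset e' in U | immediate_conflict e e'].

Definition alternative U C D J : Prop :=
  [/\ J `<=` U, configuration J, configuration (C `|` J) &
      forall e, e \in D ->
        exists2 e', e' \in C `|` J & e' \in conflicts_in U e].

Definition Q C D U : {fset event T} :=
  C `|` D `|`
    \bigcup_(e <- C `|` D) \bigcup_(e' <- conflicts_in U e) local e'.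

(* All the moves of the clean-up phase are done at once.  This is the same as
   doing them one by one, in any order: moving events outside Q C D U changes
   neither Q C D U nor, up to events whose local configurations have already
   been dealt with, the set of immediate conflicts of e. *)
Definition garbage C D U e : {fset event T} :=
  (e |` \bigcup_(e' <- conflicts_in U e) local e') `\` Q C D U.

(* Entries of the call stack: a call about to be executed, a call whose first
   recursive call on e is in progress, and a call whose only remaining action
   is the clean-up for e. *)
Inductive frame :=
| Call of {fset event T} & {fset event T} & {fset event T}
| Left of {fset event T} & {fset event T} & event T
| Right of {fset event T} & {fset event T} & event T.

Record state := State {
  stack : seq frame;
  setU : {fset event T};
  setG : {fset event T}
}.

Definition initial : state :=
  State [:: Call [fset Bot] fset0 fset0] [fset Bot] fset0.

Inductive step : state -> state -> Prop :=
| step_return C D A k U G :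
    en C `&` (U `|` ex C) = fset0 ->
    step (State (Call C D A :: k) U G) (State k (U `|` ex C) G)
| step_choose C D A k U G e :
    e \in en C `&` (U `|` ex C) -> A = fset0 \/ e \in A ->
    step (State (Call C D A :: k) U G)
         (State (Call (e |` C) D (A `\ e) :: Left C D e :: k) (U `|` ex C) G)
| step_alternative C D e k U G J :
    alternative U C (e |` D) J ->
    step (State (Left C D e :: k) U G)
         (State (Call C (e |` D) (J `\` C) :: Right C D e :: k) U G)
| step_no_alternative C D e k U G :
    (forall J, ~ alternative U C (e |` D) J) ->
    step (State (Left C D e :: k) U G) (State (Right C D e :: k) U G)
| step_remove C D e k U G :
    step (State (Right C D e :: k) U G)
         (State k (U `\` garbage C D U e) (G `|` (U `&` garbage C D U e))).

(* Maximal executions, finite or infinite: a finite one ends in a state without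
   successor, which is then repeated forever. *)
Definition execution (r : nat -> state) : Prop :=
  r 0 = initial /\
  forall n, step (r n) (r n.+1) \/
            (forall x, ~ step (r n) x) /\ r n.+1 = r n.

Definition explore_called (C : {fset event T}) (x : state) : Prop :=
  exists D A k, stack x = Call C D A :: k.

End Explore.

(* Main.v *)
(* Follow Ct down the call tree: from a call (C, D, A) with C `<=` Ct, go left
   when the chosen event e is in Ct and right otherwise.  The right call has to
   exist, i.e. U must contain an alternative to e |` D inside Ct when the left
   call returns.  Along the way Ct keeps, for every d in D, a witness: an
   immediate conflict of d whose local configuration is in U, hence protected
   by Q.  A witness for e is found by induction, using that the left call has
   explored the other maximal configurations as well: any one that contains e
   and the causes of a minimal event x of Ct in conflict with e has put x in
   U (compatible_right).  The alternative is then the union of the local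
   configurations of the witnesses. *)
Require Import Defs.
From mathcomp Require Import all_boot finmap.

Set Implicit Arguments.
Unset Strict Implicit.
Unset Printing Implicit Defensive.

Local Open Scope fset_scope.

(** * Well-foundedness of causality and elementary facts on conflict *)

Fixpoint weight (T : Type) (e : event T) : nat :=
  if e is Ev _ s then (sumn (map (@weight T) s)).+1 else 0.

Lemma weight_history (T : choiceType) (x e : event T) :
  x \in history e -> weight x < weight e.
Proof.
case: e => [|t s]; rewrite /history ?inE //= ltnS.
elim: s => //= y s IHs; rewrite inE => /orP[/eqP->|/IHs]; first exact: leq_addr.
by move=> le_xs; apply: leq_trans le_xs (leq_addl _ _).
Qed.

(** Drives the inductions of [maximal_extension] and [explore_call], whose measures are cardinals of
    complements in [E]. *)
Lemma card_fsetDU1 (K : choiceType) (A B : {fset K}) (x : K) :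
  x \in A -> x \notin B -> #|` A `\` (x |` B)| < #|` A `\` B|.
Proof.
by move=> xA xB; rewrite fsetUC -fsetDDl fproper_ltn_card // fproperD1 // inE xB.
Qed.

Lemma history_mk_event (T : choiceType) (t : T) (H : {fset event T}) :
  history (mk_event t H) = H.
Proof. by apply/fsetP => x; rewrite !inE. Qed.

Lemma causally_closedP (T : choiceType) (C : {fset event T}) :
  reflect (forall e, e \in C -> history e `<=` C) (causally_closed C).
Proof. exact: allP. Qed.

Lemma conflict_freeP (T : choiceType) (I : rel T) (C : {fset event T}) :
  reflect (forall e x, e \in C -> x \in C -> ~~ conflict I e x)
    (conflict_free I C).
Proof.
apply: (iffP allP) => [cfC e x eC | cfC e eC]; first by move/allP: (cfC e eC); apply.
by apply/allP => x; apply: cfC.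
Qed.

Lemma conflictP (T : choiceType) (I : rel T) (e x : event T) :
  reflect (exists2 e', e' \in local e & exists2 x', x' \in local x &
             direct_conflict I e' x')
    (conflict I e x).
Proof.
apply: (iffP hasP) => -[e' e'e] /hasP e'x; exists e' => //; exact/hasP.
Qed.

Lemma local_refl (T : choiceType) (e : event T) : e \in local e.
Proof. exact: fset1U1. Qed.

Lemma history_local (T : choiceType) (e : event T) : history e `<=` local e.
Proof. exact: fsubsetUr. Qed.

Lemma conflictC (T : choiceType) (I : rel T) (e x : event T) :
  symmetric I -> conflict I e x = conflict I x e.
Proof.
move=> symI.
have dirC y z : direct_conflict I y z = direct_conflict I z y.
  rewrite /direct_conflict /dependent andbCA.
  by case: (label y) (label z) => [t|] [u|]; rewrite ?andbF // symI.
by apply/conflictP/conflictP => -[y yin] [z zin]; rewrite dirC => ?;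
  exists z => //; exists y.
Qed.

Lemma conflict_bot (T : choiceType) (I : rel T) (e : event T) :
  conflict I Bot e = false.
Proof.
apply/negbTE/conflictP => -[y]; rewrite !inE orbF => /eqP-> [x _].
by rewrite /direct_conflict /dependent !andbF.
Qed.

Lemma unfolding_history_closed (Sigma : Type) (T : choiceType)
    (M : system Sigma T) (I : rel T) (e : event T) :
  unfolding M I e -> causally_closed (history e).
Proof.
case=> [|t H s _ _ ccH _ _ _ _]; last by rewrite history_mk_event.
by apply/causally_closedP => x; rewrite inE.
Qed.

(** * Configurations, their maximal extensions, and immediate conflicts *)

Section EventStructure.
Variables (T : choiceType) (I : rel T) (E : {fset event T}).
Hypothesis symI : symmetric I.
Hypothesis history_closed : forall e, e \in E -> causally_closed (history e).
Implicit Types (e x y : event T) (C D A J U G : {fset event T}).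

Lemma configurationP C :
  reflect [/\ C `<=` E, forall e, e \in C -> history e `<=` C &
              forall e x, e \in C -> x \in C -> ~~ conflict I e x]
    (configuration I E C).
Proof.
apply: (iffP and3P) => -[CE /causally_closedP ccC /conflict_freeP cfC];
  by split.
Qed.

Lemma local_closed e x : e \in E -> x \in local e -> local x `<=` local e.
Proof.
move=> eE; rewrite inE in_fset1 => /orP[/eqP->//|xe].
rewrite fsubUset fsub1set inE xe orbT; apply: fsubset_trans (history_local e).
by move/causally_closedP: (history_closed eE); apply.
Qed.

Lemma conflict_inherited e x y :
  y \in E -> x \in local y -> conflict I e x -> conflict I e y.
Proof.
move=> yE /(local_closed yE)/fsubsetP sub /conflictP[e' e'e [x' /sub ? ?]].
by apply/conflictP; exists e' => //; exists x'.
Qed.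

Lemma configuration_local C e :
  configuration I E C -> e \in C -> local e `<=` C.
Proof.
by move=> /configurationP[_ ccC _] eC; rewrite fsubUset fsub1set eC; apply: ccC.
Qed.

Lemma configuration_sub C C' : configuration I E C -> C' `<=` C ->
  (forall e, e \in C' -> history e `<=` C') -> configuration I E C'.
Proof.
move=> /configurationP[CE _ cfC] sub cc; apply/configurationP; split=> //.
  exact: fsubset_trans CE.
by move=> e x /(fsubsetP sub) ? /(fsubsetP sub) ?; apply: cfC.
Qed.

Lemma configurationU C C1 C2 : configuration I E C ->
    C1 `<=` C -> (forall e, e \in C1 -> history e `<=` C1) ->
    C2 `<=` C -> (forall e, e \in C2 -> history e `<=` C2) ->
  configuration I E (C1 `|` C2).
Proof.
move=> cC s1 c1 s2 c2; apply: configuration_sub cC _ _.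
  by rewrite fsubUset s1.
move=> e; rewrite inE => /orP[/c1|/c2] he; apply: fsubset_trans he _.
  exact: fsubsetUl.
exact: fsubsetUr.
Qed.

Lemma configurationU1 C e : configuration I E C -> e \in E ->
    ~~ conflict I e e ->
    history e `<=` C -> (forall x, x \in C -> ~~ conflict I e x) ->
  configuration I E (e |` C).
Proof.
move=> /configurationP[CE ccC cfC] eE ee he cfe; apply/configurationP; split.
- by rewrite fsubUset fsub1set eE.
- move=> x; rewrite inE in_fset1 => /orP[/eqP->|/ccC hx];
    exact: fsubset_trans (fsubsetU1 _ _).
move=> x y; rewrite !inE => /orP[/eqP->|xC] /orP[/eqP->|yC] //.
- exact: cfe.
- by rewrite conflictC //; apply: cfe.
exact: cfC.
Qed.

Lemma minimal_event C (P : pred (event T)) x : x \in C -> P x ->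
  exists2 y, y \in C & P y /\ forall z, z \in C -> z \in history y -> ~~ P z.
Proof.
have [n] := ubnP (weight x); elim: n x => // n IHn x; rewrite ltnS => le_xn xC Px.
case: (boolP (has (fun z => (z \in history x) && P z) C)) => [|/hasPn nP].
  case/hasP=> z zC /andP[zx Pz].
  exact: IHn (leq_trans (weight_history zx) le_xn) zC Pz.
exists x => //; split=> // z zC zx.
by move: (nP z zC); rewrite zx.
Qed.

(** A causally minimal event of [C'] outside [C] has all its causes in [C]. *)
Lemma en_extension C C' : configuration I E C -> configuration I E C' ->
  C `<=` C' -> ~~ (C' `<=` C) -> exists2 e, e \in C' & e \in en I E C.
Proof.
move=> cC cC' sub /fsubsetPn[x xC' xC].
have [y yC' [yC ymin]] := minimal_event (P := fun y => y \notin C) xC' xC.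
have /configurationP[C'E ccC' cfC'] := cC'.
have yE := fsubsetP C'E y yC'.
have hy : history y `<=` C.
  apply/fsubsetP => z zy; apply/negPn/ymin => //.
  exact: fsubsetP (ccC' y yC') z zy.
exists y => //; rewrite !inE yE yC hy /=.
apply: configurationU1 => //; first exact: cfC'.
by move=> z /(fsubsetP sub) zC'; apply: cfC'.
Qed.

Lemma enP C e : e \in en I E C ->
  [/\ e \in E, e \notin C, history e `<=` C & configuration I E (e |` C)].
Proof. by rewrite !inE => /andP[/and3P[]]. Qed.

Lemma maximal_en0 C : configuration I E C -> en I E C = fset0 ->
  maximal_configuration I E C.
Proof.
move=> cC en0; split=> // C' cC' sub; apply/eqP; rewrite eqEfsubset sub andbT.
by apply/negPn/negP => /(en_extension cC cC' sub)[e _]; rewrite en0 inE.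
Qed.

Lemma maximal_extension C : configuration I E C ->
  exists2 C', C `<=` C' & maximal_configuration I E C'.
Proof.
have [n] := ubnP #|`E `\` C|; elim: n C => // n IHn C; rewrite ltnS => leCn cC.
have [/(maximal_en0 cC)|[e eC]] := fset_0Vmem (en I E C); first by exists C.
have [eE e_nC _ ceC] := enP eC.
have [C' sub maxC'] := IHn _ (leq_trans (card_fsetDU1 eE e_nC) leCn) ceC.
by exists C' => //; apply: fsubset_trans sub; apply: fsubsetU1.
Qed.

Lemma maximal_conflict C e : maximal_configuration I E C -> e \in E ->
    ~~ conflict I e e -> history e `<=` C -> e \notin C ->
  exists2 x, x \in C & conflict I e x.
Proof.
move=> [cC maxC] eE ee he e_nC; apply/hasP/negPn/negP => /hasPn cfe.
have cf x (xC : x \in C) := cfe x xC.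
have := maxC _ (configurationU1 cC eE ee he cf) (fsubsetU1 _ _).
by move/fsetP/(_ e); rewrite fset1U1 (negbTE e_nC).
Qed.

(** Apart from [e], everything lies in [C]. Adding [e] creates no conflict with [history x], by
    minimality of [x], nor with [history e], since such a conflict would be inherited by [e] and
    make [e] conflict with itself. *)
Lemma minimal_conflict_immediate C e x : configuration I E C ->
    e \in E -> ~~ conflict I e e -> history e `<=` C ->
    x \in C -> conflict I e x -> (forall y, y \in history x -> ~~ conflict I e y) ->
  immediate_conflict I E e x.
Proof.
move=> cC eE ee he xC ex minx; rewrite /immediate_conflict ex /=.
have /configurationP[CE ccC cfC] := cC.
have xE := fsubsetP CE x xC.
have closed y : y \in E -> forall z, z \in history y -> history z `<=` history y.
  by move=> yE; apply/causally_closedP/history_closed.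
have closedl y : y \in E -> forall z, z \in local y -> history z `<=` local y.
  move=> yE z zy; apply: fsubset_trans (local_closed yE zy).
  exact: history_local.
have chh : configuration I E (history e `|` history x).
  by apply: (configurationU cC) => //; [apply: closed|apply: ccC|apply: closed].
apply/andP; split.
  apply: (configurationU cC) => //; first exact: closed.
    exact: configuration_local.
  exact: closedl.
rewrite -fsetUA; apply: configurationU1 => //; first exact: fsubsetUl.
move=> y; rewrite inE => /orP[ye|/minx//].
apply: contra ee; apply: conflict_inherited => //.
exact: fsubsetP (history_local e) y ye.
Qed.

(** * Inversion of the steps of Explore *)

(** Enabled events have just been added to [U] as members of [ex E C], so the test on [U] reduces to
    one on [en I E C]. *)
Lemma en_ex C U : en I E C `&` (U `|` ex E C) = en I E C.
Proof.
by apply/fsetIidPl/fsubsetP => x; rewrite !inE => /andP[->]; rewrite orbT.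
Qed.

Lemma step_call C D A k U G (s : state T) :
    step I E (State (Call C D A :: k) U G) s ->
  en I E C = fset0 /\ s = State k (U `|` ex E C) G \/
  exists e, [/\ e \in en I E C, A = fset0 \/ e \in A &
    s = State (Call (e |` C) D (A `\ e) :: Left C D e :: k) (U `|` ex E C) G].
Proof.
rewrite -[en I E C](en_ex C U).
by inversion 1; subst; [left | right; exists e].
Qed.

Lemma step_left C D e k U G (s : state T) :
    step I E (State (Left C D e :: k) U G) s ->
  (forall J, ~ alternative I E U C (e |` D) J) /\
    s = State (Right C D e :: k) U G \/
  exists2 J, alternative I E U C (e |` D) J &
    s = State (Call C (e |` D) (J `\` C) :: Right C D e :: k) U G.
Proof. by inversion 1; subst; [right; exists J | left]. Qed.

Lemma step_right C D e k U G (s : state T) :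
    step I E (State (Right C D e :: k) U G) s ->
  s = State k (U `\` garbage I E C D U e) (G `|` (U `&` garbage I E C D U e)).
Proof. by inversion 1. Qed.

(** * Invariants of a run and their preservation by the clean-up *)

Section Run.
Variable r : nat -> state T.
Hypothesis run : execution I E r.

(* x is in #_U(d), and moreover [x] is in U: this is what the clean-up phase
   preserves, and what makes [x] available for building alternatives. *)
Definition hit U d x : bool :=
  immediate_conflict I E d x && (local x `<=` U).

Definition reaches C := exists n, explore_called C (r n).

(* The last clause is what rules out choosing an event of D. *)
Definition callable C D A U : Prop :=
  [/\ configuration I E C, configuration I E (C `|` A),
      forall a, a \in A -> a \notin C, C `<=` U &
      forall d, d \in D -> exists2 x, x \in C `|` A & conflict I d x].

Definition compatible Ct C D U : Prop :=
  [/\ maximal_configuration I E Ct, C `<=` Ct &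
      forall d, d \in D -> exists2 x, x \in Ct & hit U d x].

(** The events of [C] count as well as those of [D]: a conflict with [e] discovered while [e] is in
    the first argument of the left call must still be there when [e] joins [D]. *)
Definition preserved C D U U' : Prop :=
  C `<=` U' /\ forall d x, d \in C `|` D -> hit U d x -> hit U' d x.

(* A call reaching Ct extends U by ex Ct; the immediate conflicts of C found
   there survive the clean-up of the whole call. *)
Definition covered Ct C U' : Prop :=
  reaches Ct /\
  forall c x, c \in C -> x \in ex E Ct -> immediate_conflict I E c x ->
    hit U' c x.

Lemma run_step n (x : state T) : step I E (r n) x -> step I E (r n) (r n.+1).
Proof. by case: run => _ /(_ n)[//|[stuck _]] /stuck. Qed.

Lemma hitP U d x : hit U d x ->
  [/\ immediate_conflict I E d x, conflict I d x, x \in E, x \in U &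
      local x `<=` U].
Proof.
case/andP=> ic lxU; split=> //; first by case/and3P: ic.
  case/and3P: ic => _ /configurationP[sub _ _] _.
  by apply: (fsubsetP sub); rewrite inE local_refl orbT.
by apply: (fsubsetP lxU); apply: local_refl.
Qed.

Lemma hit_sub U U' d x : U `<=` U' -> hit U d x -> hit U' d x.
Proof. by move=> sub /andP[ic lx]; rewrite /hit ic (fsubset_trans lx). Qed.

Lemma compatible_sub Ct C D U U' : U `<=` U' ->
  compatible Ct C D U -> compatible Ct C D U'.
Proof.
move=> sub [mx CCt hD]; split=> // d /hD[x xCt hx].
by exists x => //; apply: hit_sub hx.
Qed.

Lemma preserved_trans C D U U1 U2 :
  preserved C D U U1 -> preserved C D U1 U2 -> preserved C D U U2.
Proof. by move=> [_ p1] [CU2 p2]; split=> // d x dCD /p1 hx; apply/p2/hx. Qed.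

Lemma preserved_sub C D U C1 D1 V U1 : C `<=` C1 -> D `<=` D1 -> U `<=` V ->
  preserved C1 D1 V U1 -> preserved C D U U1.
Proof.
move=> sC sD sU [CU1 p]; split=> [|d x dCD /(hit_sub sU)].
  exact: fsubset_trans CU1.
by apply: p; apply: (fsubsetP (fsetUSS sC sD)).
Qed.

(** The garbage avoids [Q], which contains [C] and the local configuration of each immediate
    conflict in [U] of an event of [C] or [D]. *)
Lemma preserved_garbage C D U e : C `<=` U ->
  preserved C D U (U `\` garbage I E C D U e).
Proof.
move=> CU; have QU x : x \in U -> x \in Q I E C D U ->
    x \in U `\` garbage I E C D U e.
  by move=> xU xQ; rewrite in_fsetD xU andbT in_fsetD xQ.
split.
  apply/fsubsetP => x xC; apply: QU; first exact: fsubsetP xC.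
  by rewrite !inE xC.
move=> d x dCD hx; have [ic _ _ xU lxU] := hitP hx.
rewrite /hit ic; apply/fsubsetP => y yx; apply: QU; first exact: (fsubsetP lxU).
rewrite /Q inE; apply/orP; right.
apply/bigfcupP; exists d; first by rewrite dCD.
by apply/bigfcupP; exists x => //; rewrite !inE xU ic.
Qed.

Lemma compatible_preserved Ct C D C1 D1 U U1 : D `<=` C1 `|` D1 ->
  preserved C1 D1 U U1 -> compatible Ct C D U -> compatible Ct C D U1.
Proof.
move=> sD [_ p1] [mx CCt hD]; split=> // d dD.
have [x xCt hx] := hD d dD; exists x => //; apply: p1 hx.
exact: (fsubsetP sD).
Qed.

Lemma covered_preserved Ct C C1 D1 D2 U1 U2 : C `<=` C1 ->
  preserved C D2 U1 U2 -> covered Ct C1 U1 -> covered Ct C U2.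
Proof.
move=> sC [_ p] [rc cov]; split=> // c x cC xex ic.
apply: p; first by rewrite inE cC.
by apply: cov => //; apply: (fsubsetP sC).
Qed.

(* Either a witness against some d in D already contains a conflict with e, or
   all the witnesses are compatible with e; then e together with the events of
   Ct that do not conflict with it extends to a maximal configuration covered
   by the call on e |` C, where the sought conflict has been discovered. *)
Lemma compatible_right Ct C D U U1 e :
    e \in en I E C -> e \notin Ct ->
    compatible Ct C D U -> preserved (e |` C) D U U1 ->
    (forall C', compatible C' (e |` C) D U -> covered C' (e |` C) U1) ->
  compatible Ct C (e |` D) U1.
Proof.
move=> /enP[eE e_nC he ceC] e_nCt comp pres cov.
have [mxCt CCt hDU] := comp; have cCt := mxCt.1.
have /configurationP[CtE ccCt cfCt] := cCt.
have heCt : history e `<=` Ct := fsubset_trans he CCt.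
have ee : ~~ conflict I e e.
  by have /configurationP[_ _] := ceC; apply; apply: fset1U1.
have [_ _ hDU1] : compatible Ct C D U1.
  by apply: compatible_preserved pres comp; apply: fsubsetUr.
suff [x xCt hx] : exists2 x, x \in Ct & hit U1 e x.
  split=> // d; rewrite inE in_fset1 => /orP[/eqP->|/hDU1//].
  by exists x.
(* Despite its name, [bad d] is the favourable case: some witness against [d] does not conflict with
   [e], hence survives in [K] below. *)
pose bad d := has (fun x => hit U d x && ~~ conflict I e x) Ct.
case: (boolP (all bad D)) => [/allP allD | /allPn[d dD /hasPn badd]].
  pose K := e |` [fset x in Ct | ~~ conflict I e x].
  have cK : configuration I E K.
    apply: configurationU1 => //; last by move=> x; rewrite !inE => /andP[].
      apply: (configuration_sub cCt); first by apply/fsubsetP=> x /[!inE]/andP[].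
      move=> x /[!inE]/andP[xCt ex]; apply/fsubsetP => y yx.
      rewrite !inE (fsubsetP (ccCt x xCt)) //=; apply: contra ex.
      apply: conflict_inherited; first exact: (fsubsetP CtE).
      exact: (fsubsetP (history_local x)).
    apply/fsubsetP => x xe; rewrite !inE (fsubsetP heCt) //=.
    apply: contra ee; apply: conflict_inherited => //.
    exact: (fsubsetP (history_local e)).
  have [C2 KC2 mxC2] := maximal_extension cK.
  have [x0 x0Ct ex0] := maximal_conflict mxCt eE ee heCt e_nCt.
  have [x xCt [ex xmin]] := minimal_event (P := conflict I e) x0Ct ex0.
  have hxCt := ccCt x xCt.
  have {}xmin y : y \in history x -> ~~ conflict I e y.
    by move=> yx; apply: xmin => //; apply: (fsubsetP hxCt).
  exists x => //; have eC2 : e \in C2 by apply/(fsubsetP KC2)/fset1U1.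
  have /configurationP[_ _ cfC2] := mxC2.1.
  have compC2 : compatible C2 (e |` C) D U.
    split=> //.
      apply: fsubset_trans KC2; apply/fsubsetP => y.
      rewrite !inE => /orP[->//|yC]; apply/orP; right.
      rewrite (fsubsetP CCt) //=.
      have /configurationP[_ _] := ceC; apply; first exact: fset1U1.
      by rewrite inE yC orbT.
    move=> d /allD/hasP[y yCt /andP[hy ey]]; exists y => //.
    by apply/(fsubsetP KC2); rewrite !inE yCt ey orbT.
  have [_ covC2] := cov _ compC2.
  apply: covC2; first exact: fset1U1.
    (* [x] is outside [C2] because it conflicts with [e]; its causes do not, so they lie in [K] and
       thus in [C2]. *)
    rewrite !inE (fsubsetP CtE) //=; apply/andP; split.
      by apply: contraL ex => xC2; apply: cfC2.
    apply: fsubset_trans KC2; apply/fsubsetP => y yx.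
    by rewrite !inE (fsubsetP hxCt) // xmin // orbT.
  exact: minimal_conflict_immediate cCt eE ee heCt xCt ex xmin.
have [x xCt hx] := hDU d dD.
have {badd} : conflict I e x by move: (badd x xCt); rewrite hx /= negbK.
have {}hx : hit U1 d x by apply: pres.2 hx; rewrite inE dD orbT.
have [_ _ xE _ lxU1] := hitP hx.
(* A minimal conflict with [e] inside [local x] has its own local configuration inside [local x],
   which is still in [U1]. *)
move/(minimal_event (local_refl x)) => [y yx [ey ymin]].
have yCt : y \in Ct by apply: (fsubsetP (configuration_local cCt xCt)).
have lyx := local_closed xE yx.
exists y => //; rewrite /hit (fsubset_trans lyx lxU1) andbT.
apply: minimal_conflict_immediate (cCt) eE ee heCt yCt ey _ => z zy.
apply: ymin => //; apply: (fsubsetP lyx).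
exact: (fsubsetP (history_local y)).
Qed.

(** * Existence of alternatives and progress of calls *)

Lemma compatible_alternative Ct C D U : configuration I E C ->
  compatible Ct C D U -> exists J, alternative I E U C D J.
Proof.
move=> cC [[cCt _] CCt hD].
have /configurationP[CtE ccCt _] := cCt.
(* No witness has to be chosen: [J] takes every available local configuration in [Ct]. As a causally
   closed part of [Ct], it is a configuration, and so is its union with [C]. *)
pose J := \bigcup_(x <- Ct | local x `<=` U) local x.
have JP y : reflect (exists2 x, x \in Ct & (local x `<=` U) /\ y \in local x)
                    (y \in J).
  apply: (iffP (bigfcupP _ _ _ _)) => [[x /andP[xCt lx] yx]|[x xCt [lx yx]]].
    by exists x.
  by exists x => //; rewrite xCt.
have JCt : J `<=` Ct.
  apply/fsubsetP => y /JP[x xCt [_ yx]].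
  exact: (fsubsetP (configuration_local cCt xCt)).
have ccJ y : y \in J -> history y `<=` J.
  case/JP=> x xCt [lx yx]; apply/fsubsetP => z zy; apply/JP; exists x => //.
  split=> //; apply: (fsubsetP (local_closed (fsubsetP CtE x xCt) yx)).
  exact: (fsubsetP (history_local y)).
exists J; split.
- by apply/fsubsetP => y /JP[x _ [lx yx]]; apply: (fsubsetP lx).
- exact: configuration_sub JCt ccJ.
- apply: (configurationU cCt) => //.
  by have /configurationP[] := cC.
move=> d /hD[x xCt hx]; have [ic _ _ xU lx] := hitP hx.
exists x; last by rewrite !inE xU ic.
by rewrite inE; apply/orP; right; apply/JP; exists x; rewrite ?local_refl.
Qed.

Lemma callable_choice C D A U e : callable C D A U ->
    e \in en I E C -> A = fset0 \/ e \in A ->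
  e \notin D /\ callable (e |` C) D (A `\ e) (U `|` ex E C).
Proof.
move=> [cC cCA disj CU confD] een Ae; have [eE e_nC he ceC] := enP een.
(* An event chosen from [A] leaves the planned configuration, the union of [C] and [A], unchanged;
   otherwise [A] is empty and the plan becomes [e] with [C]. *)
have CA : e |` C `|` A `\ e = if e \in A then C `|` A else e |` C.
  case: Ae => [->|eA]; first by rewrite inE fset0D fsetU0.
  by rewrite eA fsetUAC fsetD1K // fsetUC.
have CAe : configuration I E (e |` C `|` A `\ e) by rewrite CA; case: ifP.
have sCA : C `|` A `<=` e |` C `|` A `\ e.
  by apply/fsubsetP => x; rewrite !inE; case: eqP.
split.
  (* The planned configuration contains a conflict of each event of [D], so it cannot contain an
     event of [D]. *)
  apply/negP => /confD[x xCA ex].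
  have /configurationP[_ _ cf] := CAe.
  suff : ~~ conflict I e x by rewrite ex.
  by apply: cf; [rewrite !inE eqxx | apply: (fsubsetP sCA)].
split=> //.
- move=> a; rewrite !inE => /andP[/negbTE-> aA] /=; exact: disj.
- apply/fsubsetP => x; rewrite !inE => /orP[/eqP->|xC].
    by rewrite eE e_nC he orbT.
  by rewrite (fsubsetP CU).
by move=> d /confD[x xCA dx]; exists x => //; apply: (fsubsetP sCA).
Qed.

Lemma callable_alternative C D J U : configuration I E C -> C `<=` U ->
  alternative I E U C D J -> callable C D (J `\` C) U.
Proof.
have CJ : C `|` J `\` C = C `|` J.
  by apply/fsetP => x; rewrite !inE; case: (x \in C).
move=> cC CU [_ _ cCJ hD]; split=> //; rewrite ?CJ //.
  by move=> a /[!inE]/andP[].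
by move=> d /hD[x xCJ /[!inE]/andP[_ /and3P[]]]; exists x.
Qed.

(** If [A] is nonempty, it properly extends [C] to a configuration; some event of that extension is
    enabled, and being outside [C] it is in [A]. *)
Lemma choice_exists C D A U : callable C D A U -> en I E C != fset0 ->
  exists2 e, e \in en I E C & A = fset0 \/ e \in A.
Proof.
move=> [cC cCA disj _ _] /fset0Pn[e eC].
have [A0|[a aA]] := fset_0Vmem A; first by exists e => //; left.
have [|x] := en_extension cC cCA (fsubsetUl _ _).
  by apply/fsubsetPn; exists a; rewrite ?disj // inE aA orbT.
rewrite inE => /orP[xC|xA] xen; last by exists x => //; right.
by have [_ /negP[]] := enP xen.
Qed.

(** * Induction over the call tree *)

(** Termination and coverage are proved together. The measure drops because the left call enlarges
    [C] and the right call enlarges [D], each by an event of [E]. *)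
Lemma explore_call n C D A k U G :
    r n = State (Call C D A :: k) U G -> callable C D A U ->
  exists m U' G', [/\ r m = State k U' G', preserved C D U U' &
    forall Ct, compatible Ct C D U -> covered Ct C U'].
Proof.
have [s] := ubnP (#|`E `\` C| + #|`E `\` D|).
elim: s n C D A k U G => // s IH n C D A k U G; rewrite ltnS => les rn cal.
have [cC cCA disj CU confD] := cal.
have : step I E (r n) (r n.+1).
  have [en0|/(choice_exists cal)[e een Ae]] := eqVneq (en I E C) fset0.
    by apply: run_step; rewrite rn; apply: step_return; rewrite en_ex; exact: en0.
  by apply: run_step; rewrite rn; apply: step_choose Ae; rewrite en_ex; exact: een.
rewrite rn => /step_call[[en0 rn1]|[e [een Ae rn1]]].
  exists n.+1, (U `|` ex E C), G; split=> //.
    split; first exact: fsubset_trans (fsubsetUl _ _).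
    by move=> d x _; apply: hit_sub; apply: fsubsetUl.
  (* Nothing is enabled, so [C] is maximal and is the only candidate for [Ct]. *)
  move=> Ct [[cCt _] CCt _]; have [_ mxC] := maximal_en0 cC en0.
  have -> := mxC _ cCt CCt.
  split; first by exists n, D, A, k; rewrite rn.
  move=> c x _ xex ic; rewrite /hit ic fsubUset fsub1set inE xex orbT /=.
  move: xex; rewrite !inE => /and3P[_ _ hx].
  by apply: fsubset_trans hx (fsubset_trans CU (fsubsetUl _ _)).
have [eE e_nC he ceC] := enP een.
have [e_nD calL] := callable_choice cal een Ae.
have UV : U `<=` U `|` ex E C := fsubsetUl _ _.
have ltC := card_fsetDU1 eE e_nC.
have ltD := card_fsetDU1 eE e_nD.
have [|m [U1 [G1 [rm pL covL]]]] := IH _ _ _ _ _ _ _ _ rn1 calL.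
  by apply: leq_trans les; rewrite ltn_add2r.
have sCeC : C `<=` e |` C := fsubsetU1 _ _.
have pL' : preserved C D U U1 by apply: preserved_sub pL.
have compR Ct : compatible Ct C D U -> e \notin Ct -> compatible Ct C (e |` D) U1.
  by move=> comp e_nCt; exact: compatible_right een e_nCt (compatible_sub UV comp) pL covL.
have covE Ct : compatible Ct C D U -> e \in Ct -> covered Ct (e |` C) U1.
  move=> /(compatible_sub UV)[mx CCt hD] eCt; apply: covL; split=> //.
  by rewrite fsubUset fsub1set eCt.
(* With or without a right call, the run reaches the [Right] frame; the clean-up is then treated
   once for both cases. *)
suff [m' [U2 [G2 [rm' pR covR]]]] : exists m' U2 G2,
    [/\ r m' = State (Right C D e :: k) U2 G2, preserved C D U1 U2 &
        forall Ct, compatible Ct C (e |` D) U1 -> covered Ct C U2].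
  have : step I E (r m') (r m'.+1).
    by apply: run_step; rewrite rm'; apply: step_remove.
  rewrite rm' => /step_right rm1.
  have pG := preserved_garbage D e pR.1.
  exists m'.+1, (U2 `\` garbage I E C D U2 e), (G2 `|` (U2 `&` garbage I E C D U2 e)).
  split=> // [|Ct comp]; first exact: preserved_trans pL' (preserved_trans pR pG).
  have [eCt|e_nCt] := boolP (e \in Ct).
    exact: covered_preserved sCeC (preserved_trans pR pG) (covE _ comp eCt).
  exact: covered_preserved (fsubset_refl _) pG (covR _ (compR _ comp e_nCt)).
have : step I E (r m) (r m.+1).
  (* Existence of an alternative need not be decided: a stuck run would have none, and then
     [step_no_alternative] would apply. *)
  case: (run) => _ /(_ m)[//|[stuck _]]; case: (stuck (State (Right C D e :: k) U1 G1)).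
  rewrite rm; apply: step_no_alternative => J altJ.
  by apply: (stuck _); rewrite rm; apply: step_alternative altJ.
rewrite rm => /step_left[[noJ rm1]|[J altJ rm1]].
  exists m.+1, U1, G1; split=> //; first by split=> //; exact: pL'.1.
  (* Without an alternative no [Ct] is compatible, so coverage is vacuous. *)
  by move=> Ct /(compatible_alternative cC)[J /noJ].
have calR := callable_alternative cC pL'.1 altJ.
have [|m' [U2 [G2 [rm' pR covR]]]] := IH _ _ _ _ _ _ _ _ rm1 calR.
  by apply: leq_trans les; rewrite ltn_add2l.
exists m', U2, G2; split=> //; apply: preserved_sub pR => //.
exact: fsubsetU1.
Qed.

End Run.
End EventStructure.

Theorem theorem4 (Sigma : Type) (T : choiceType) (M : system Sigma T)
    (I : rel T) (E : {fset event T}) (Ct : {fset event T})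
    (r : nat -> state T) :
  unconditional_independence M I ->
  (forall e : event T, e \in E <-> unfolding M I e) ->
  maximal_configuration I E Ct ->
  execution I E r ->
  exists n : nat, explore_called Ct (r n).
Proof.
move=> [symI _ _] EU mxCt run.
have history_closed e : e \in E -> causally_closed (history e).
  by move=> /EU/unfolding_history_closed.
have botE : Bot \in E by apply/EU/unfolding_bot.
have cBot : configuration I E [fset Bot].
  apply/configurationP; split; first by rewrite fsub1set.
    by move=> e /[!inE]/eqP->; apply: fsub0set.
  by move=> e x /[!inE]/eqP-> _; rewrite conflict_bot.
(* [Bot] has no causes and conflicts with nothing, so maximality forces it into [Ct]. *)
have botCt : Bot \in Ct.
  have [cCt maxCt] := mxCt.
  have cbCt : configuration I E (Bot |` Ct).
    apply: configurationU1 => //; rewrite ?conflict_bot ?fsub0set //.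
    by move=> x _; rewrite conflict_bot.
  by rewrite -(maxCt _ cbCt (fsubsetU1 _ _)) fset1U1.
have cal : callable I E [fset Bot] fset0 fset0 [fset Bot].
  by split; rewrite ?fsetU0 // => ?; rewrite inE.
have comp : compatible I E Ct [fset Bot] fset0 [fset Bot].
  by split; rewrite ?fsub1set // => ?; rewrite inE.
have [? [? [? [_ _ cov]]]] := explore_call symI history_closed run run.1 cal.
exact: (cov _ comp).1.
Qed.
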